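(* Let $\mathbb G$ be a finite graph such that the valency of every vertex is at least $3$. Let $f:\{\text{edges of }\mathbb G\}\to\mathbf R$ be any function, and denote also by $f$ the induced function on the set of edges of any (topological) covering of $\mathbb G$. For a loop $C$ of a covering of $\mathbb G$, set $f(C)=\sum_{x\in\{\text{edges of }C\}}f(x)$. If $f(C)=0$ for every loop $C$ of every covering of $\mathbb G$, then $f=0$.
   Context: Graphs are unoriented and may have multiple edges and edges whose two ends are the same vertex; each edge consists of two half-edges (branches), and the valency of a vertex is the number of half-edges ending at it. A loop of a graph is a cyclic sequence of oriented edges such that the end of each edge is the beginning of the following one, and which never goes through the same vertex or the same (unoriented) edge twice; an edge with equal end points is itself a loop. For a covering $\mathbb G_1\to\mathbb G$, the induced function on the edges of $\mathbb G_1$ is the composition of $f$ with the map from edges of $\mathbb G_1$ to edges of $\mathbb G$. *)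

(* Defs.v *)
From HB Require Import structures.
From mathcomp Require Import all_boot all_order all_algebra.
From mathcomp Require Import reals.

Set Implicit Arguments.
Unset Strict Implicit.
Unset Printing Implicit Defensive.

Import GRing.Theory.
Local Open Scope ring_scope.

(* The half-edges of an edge [e] are [(e, false)] and [(e, true)]. The boolean
   only names the two half-edges: since the morphisms below need not preserve
   it, it does not orient the graph. [V] and [E] are arbitrary types because
   coverings of a finite graph may be infinite. *)
Record graph (V E : Type) := Graph { half_edge_end : E * bool -> V }.

Definition opposite (E : Type) (h : E * bool) : E * bool := (h.1, ~~ h.2).

Definition valency (V E : finType) (G : graph V E) (v : V) : nat :=
  #|[set h : E * bool | half_edge_end G h == v]|.

(* An oriented edge is encoded by the half-edge on which it terminates. *)
Definition target (V E : Type) (G : graph V E) (h : E * bool) : V :=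
  half_edge_end G h.

Definition source (V E : Type) (G : graph V E) (h : E * bool) : V :=
  half_edge_end G (opposite h).

(* [ordS] is the successor modulo [n], so the sequence [c] is read cyclically.
   Injectivity of [fst \o c] concerns unoriented edges; it excludes the
   back-and-forth path of length 2 along a single edge. *)
Definition is_loop (V E : Type) (G : graph V E) (n : nat)
    (c : 'I_n -> E * bool) : Prop :=
  [/\ (0 < n)%N,
      forall i : 'I_n, target G (c i) = source G (c (ordS i)),
      injective (fun i : 'I_n => source G (c i)) &
      injective (fun i : 'I_n => (c i).1)].

(* A covering space of a graph carries a unique graph structure for which the
   projection is a graph morphism; being a covering then means that the
   half-edges at each vertex map bijectively to those at its image. Neither
   graph has to be connected. *)
Record covering (V1 E1 V E : Type) (G1 : graph V1 E1) (G : graph V E) :=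
  Covering {
    cov_vertex : V1 -> V;
    cov_half_edge : E1 * bool -> E * bool;
    cov_opposite : forall h : E1 * bool,
      cov_half_edge (opposite h) = opposite (cov_half_edge h);
    cov_end : forall h : E1 * bool,
      half_edge_end G (cov_half_edge h) = cov_vertex (half_edge_end G1 h);
    cov_star : forall (v : V1) (h : E * bool),
      half_edge_end G h = cov_vertex v ->
      exists! h1 : E1 * bool, half_edge_end G1 h1 = v /\ cov_half_edge h1 = h;
    cov_surj : forall v : V, exists v1 : V1, cov_vertex v1 = v
  }.

(* By [cov_opposite], choosing [(e, false)] would give the same edge. *)
Definition cov_edge (V1 E1 V E : Type) (G1 : graph V1 E1) (G : graph V E)
    (p : covering G1 G) (e : E1) : E :=
  (cov_half_edge p (e, true)).1.

Definition loop_sum (R : realType) (E : Type) (f : E -> R) (n : nat)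
    (c : 'I_n -> E * bool) : R :=
  \sum_(i < n) f (c i).1.

(* Main.v *)
(** A closed walk without backtracking, not even where its end meets its start,
    lifts to a loop of a finite covering: if it has length [n], use [n] sheets
    and let its [i]-th step lead from sheet [i] to sheet [i + 1] modulo [n]. The
    absence of backtracking says that this prescribes a partial injection of the sheets
    over each edge, and a partial injection extends to a permutation. So [f]
    sums to 0 along all these walks.

    Since valencies are at least 3, each oriented edge [h] starts a
    non-backtracking walk that ends with the reverse of [h]. For distinct edges
    [a], [b], [c] leaving a vertex, such walks can be concatenated pairwise;
    hence [f] also sums to 0 along each of them. Removing [h] and its reverse
    from the two ends leaves a closed walk at the target of [h], of sum 0 as
    well, so [2 f(h) = 0]. *)

Require Import Defs.
From mathcomp Require Import all_boot all_order all_algebra fingroup perm.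
From mathcomp Require Import reals.

Set Implicit Arguments.
Unset Strict Implicit.
Unset Printing Implicit Defensive.

Import GRing.Theory Num.Theory.
Local Open Scope ring_scope.

(** Induction on [s]: the permutation found for the tail is followed by a transposition correcting
    the image of [a i]; it fixes [b j] whenever [a j] differs from [a i]. *)
Lemma perm_extends_partial_injection (T : finType) (I : eqType) (s : seq I)
    (a b : I -> T) :
  {in s &, forall i j, (a i == a j) = (b i == b j)} ->
  exists t : {perm T}, {in s, forall i, t (a i) = b i}.
Proof.
elim: s => [|i s IHs] ab; first by exists 1%g.
have [|t tab] := IHs.
  by move=> j k sj sk; apply: ab; rewrite inE ?sj ?sk orbT.
exists (t * tperm (t (a i)) (b i))%g => j sj; rewrite permM.
have := ab i j (mem_head _ _) sj.
have [<- /esym/eqP <-|aij /esym/negbT bij] := eqVneq (a i) (a j).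
  by rewrite tpermL.
have js : j \in s.
  by move: sj aij; rewrite inE => /predU1P[->|//]; rewrite eqxx.
by rewrite -(tab _ js) tpermD ?(inj_eq perm_inj) // tab.
Qed.

Lemma opposite_involutive (E : Type) : involutive (@opposite E).
Proof. by case=> e b; rewrite /opposite /= negbK. Qed.

Lemma opposite_neq (E : eqType) (h : E * bool) : opposite h != h.
Proof. by case: h => e [] /=; rewrite xpair_eqE eqxx. Qed.

Section PermutationCovering.

Variables (V E : Type) (G : graph V E) (n : nat) (sigma : E -> {perm 'I_n}).

(** Permutation voltage graph: the lifts of an edge are indexed by the sheet of their [false]
    end. *)
Definition perm_graph : graph (V * 'I_n) (E * 'I_n) :=
  Graph (fun h : (E * 'I_n) * bool =>
    (half_edge_end G (h.1.1, h.2), if h.2 then sigma h.1.1 h.1.2 else h.1.2)).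

Lemma perm_covering (n_gt0 : (0 < n)%N) :
  exists p : covering perm_graph G, forall e, cov_edge p e = e.1.
Proof.
pose proj_half (h : (E * 'I_n) * bool) := (h.1.1, h.2).
have projN h : proj_half (opposite h) = opposite (proj_half h) by [].
have proj_end h : half_edge_end G (proj_half h) =
                  (half_edge_end perm_graph h).1 by [].
have star (v : V * 'I_n) (h : E * bool) : half_edge_end G h = v.1 ->
    exists! h1, half_edge_end perm_graph h1 = v /\ proj_half h1 = h.
  case: v h => v j [e b] /= eb.
  exists ((e, if b then (sigma e)^-1%g j else j), b); split.
    by rewrite /proj_half /= eb; case: b {eb} => //=; rewrite permKV.
  case=> [[e' i] b'] [] [_ <-] [-> ->] /=.
  by case: b {eb}; rewrite ?permK.
have surj v : exists v1 : V * 'I_n, v1.1 = v by exists (v, Ordinal n_gt0).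
by exists (Covering projN proj_end star surj).
Qed.

End PermutationCovering.

Section Walks.

Variables (V E : finType) (G : graph V E).
Implicit Types (x y h : E * bool) (p s : seq (E * bool)).

Definition reduced_step : rel (E * bool) :=
  fun x y => (target G x == source G y) && (y != opposite x).

Lemma reduced_walk_lifts_to_loop n (w : 'I_n -> E * bool) :
    (0 < n)%N -> (forall i, reduced_step (w i) (w (ordS i))) ->
  exists sigma : E -> {perm 'I_n},
  exists2 c : 'I_n -> (E * 'I_n) * bool,
    is_loop (perm_graph G sigma) c & forall i, (c i).1.1 = (w i).1.
Proof.
move=> n_gt0 w_step.
have w_red i : w (ordS i) != opposite (w i) by case/andP: (w_step i).
(* Sheets of the [false] and the [true] end of the lift of [w i], which is to lead from sheet [i] to
   sheet [ordS i]. *)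
pose a i := if (w i).2 then i else ordS i.
pose b i := if (w i).2 then ordS i else i.
(* Steps along one edge in the same direction use different sheets; in opposite directions, a common
   sheet would make them consecutive, hence a backtracking. *)
have a_inj i j : (w i).1 = (w j).1 -> a i = a j -> i = j.
  rewrite /a; case wi: (w i) => [e []]; case wj: (w j) => [e' []] //= ee' ij.
  - by have := w_red j; rewrite -ij wi wj /opposite /= ee' eqxx.
  - by have := w_red i; rewrite ij wi wj /opposite /= ee' eqxx.
  - exact: ordS_inj.
have b_inj i j : (w i).1 = (w j).1 -> b i = b j -> i = j.
  rewrite /b; case wi: (w i) => [e []]; case wj: (w j) => [e' []] //= ee' ij.
  - exact: ordS_inj.
  - by have := w_red i; rewrite ij wi wj /opposite /= ee' eqxx.
  - by have := w_red j; rewrite -ij wi wj /opposite /= ee' eqxx.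
have sigmaP e : exists t : {perm 'I_n},
    forall i, (w i).1 = e -> t (a i) = b i.
  have [|t tab] := @perm_extends_partial_injection _ _
      [seq i <- enum 'I_n | (w i).1 == e] a b.
    move=> i j; rewrite !mem_filter => /andP[/eqP ie _] /andP[/eqP je _].
    by apply/eqP/eqP => [/a_inj|/b_inj] ->; rewrite ?ie ?je.
  by exists t => i ie; apply: tab; rewrite mem_filter ie eqxx mem_enum.
have [sigma sigma_ab] := fin_all_exists sigmaP.
exists sigma, (fun i => (((w i).1, a i), (w i).2)) => //.
have srcE i : source (perm_graph G sigma) ((w i).1, a i, (w i).2) =
              (source G (w i), i).
  rewrite /source /= /opposite /=; have := sigma_ab _ i erefl.
  by rewrite /a /b; case: (w i).2 => //= ->.
have tgtE i : target (perm_graph G sigma) ((w i).1, a i, (w i).2) =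
              (target G (w i), ordS i).
  rewrite /target /=; have := sigma_ab _ i erefl.
  by rewrite /a /b; case: (w i) => e [] //= ->.
split=> //.
- by move=> i; rewrite srcE tgtE; case/andP: (w_step i) => /eqP->.
(* The vertices are distinct since the [i]-th lies in sheet [i]. *)
- by move=> i j; rewrite !srcE => -[].
- by move=> i j /= [/a_inj].
Qed.

Lemma reduced_step_opposite x y :
  reduced_step x y = reduced_step (opposite y) (opposite x).
Proof.
rewrite /reduced_step /source /target !opposite_involutive.
by congr (_ && ~~ _); apply: eq_sym.
Qed.

Lemma connect_opposite x y : connect reduced_step x y ->
  connect reduced_step (opposite y) (opposite x).
Proof.
case/connectP=> p; elim: p x => [|z p IHp] x /= => [_ ->|] //.
case/andP=> xz /IHp{}IHp /IHp; move/connect_trans; apply.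
by apply: connect1; rewrite -reduced_step_opposite.
Qed.

Lemma card_sources v : #|[set h | source G h == v]| = valency G v.
Proof.
rewrite -[RHS](card_preimset _ (inv_inj (@opposite_involutive E))).
by apply: eq_card => h; rewrite !inE.
Qed.

Hypothesis valency_ge3 : forall v, (3 <= valency G v)%N.

(** Of the at least three oriented edges leaving the target of [x], only [opposite x] is
    excluded. *)
Lemma card_successors x : (1 < #|[set y | reduced_step x y]|)%N.
Proof.
have := valency_ge3 (target G x); rewrite -card_sources.
rewrite (cardsD1 (opposite x)) inE /source opposite_involutive eqxx add1n ltnS.
by congr (_ < _)%N; apply: eq_card => y; rewrite !inE andbC eq_sym.
Qed.

(* Otherwise, among the oriented edges reachable from [h], each one has at least
   two successors but at most one predecessor. *)
Lemma connect_to_opposite h : connect reduced_step h (opposite h).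
Proof.
pose S := [set x | connect reduced_step h x].
have S_step x y : x \in S -> reduced_step x y -> y \in S.
  by rewrite !inE => hx /connect1; apply: connect_trans.
apply/negPn/negP => h_h'.
have S_opp x : x \in S -> opposite x \notin S.
  rewrite !inE => hx; apply: contra h_h' => /connect_opposite.
  by rewrite opposite_involutive; apply: connect_trans.
(* If [y] had two predecessors in [S], a step would lead from one to the reverse of the other, which
   is not in [S]. *)
have pred_le1 y : (#|[set x in S | reduced_step x y]| <= 1)%N.
  apply/card_le1_eqP => x1 x2.
  rewrite inE => /andP[Sx1 /andP[/eqP tx1 _]].
  rewrite inE => /andP[Sx2 /andP[/eqP tx2 _]].
  apply/eqP/negPn/negP => x12; apply/negP: (S_opp x2 Sx2); rewrite negbK.
  apply: (S_step x1) => //.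
  rewrite /reduced_step tx1 -tx2 /source opposite_involutive eqxx /=.
  by rewrite (inj_eq (inv_inj (@opposite_involutive E))).
(* Counting the steps inside [S] by their first and by their second edge gives [2 * #|S| <= #|S|],
   but [S] contains [h]. *)
have: (\sum_(x in S) 2 <= \sum_(z in S) 1)%N.
  apply: (@leq_trans (\sum_(x in S) \sum_(z in S) reduced_step x z)%N).
    apply: leq_sum => x Sx; apply: leq_trans (card_successors x) _.
    rewrite -sum1_card big_mkcond [leqRHS]big_mkcond; apply: leq_sum => z _.
    by rewrite inE; case: ifP => // xz; rewrite (S_step x z Sx xz).
  rewrite exchange_big; apply: leq_sum => z Sz; apply: leq_trans (pred_le1 z).
  rewrite -sum1_card big_mkcond [leqRHS]big_mkcond; apply: leq_sum => x _.
  by rewrite inE; case: (x \in S); case: reduced_step.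
rewrite !sum_nat_const leq_mul2l orbF cards_eq0 => /eqP S0.
by have := in_set0 h; rewrite -S0 inE connect0.
Qed.

Variables (R : realType) (f : E -> R).
Hypothesis f_loop : forall (V1 E1 : Type) (G1 : graph V1 E1)
    (p : covering G1 G) (n : nat) (c : 'I_n -> E1 * bool),
  is_loop G1 c -> loop_sum (fun e1 : E1 => f (cov_edge p e1)) c = 0.

Lemma sum_cyclically_reduced s :
  path.cycle reduced_step s -> \sum_(x <- s) f x.1 = 0.
Proof.
case: s => [|x p]; first by rewrite big_nil.
rewrite /path.cycle => /(pathP x); rewrite size_rcons => steps.
pose w (i : 'I_(size p).+1) := nth x (x :: p) i.
have w_step i : reduced_step (w i) (w (ordS i)).
  have := steps i (ltn_ord i); rewrite -rcons_cons !nth_rcons ltn_ord /w /=.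
  case: (ltngtP i (size p)) => [ip|ip|->]; last by rewrite modnn.
    by rewrite modn_small.
  by rewrite ltnNge -ltnS ltn_ord in ip.
have [sigma [c c_loop cE]] := reduced_walk_lifts_to_loop (ltn0Sn _) w_step.
have [q qE] := perm_covering G sigma (ltn0Sn (size p)).
rewrite -[RHS](f_loop q c_loop) /loop_sum (big_nth x) big_mkord.
by apply: eq_bigr => i _; rewrite qE cE.
Qed.

(** Backtracking from the end to the start is allowed, as it occurs for a walk from [h] to
    [opposite h]. *)
Lemma sum_closed_reduced x p : path reduced_step x p ->
  target G (last x p) = source G x -> \sum_(y <- x :: p) f y.1 = 0.
Proof.
have cat_sum y z p1 p2 : path reduced_step y p1 -> path reduced_step z p2 ->
    reduced_step (last y p1) z -> reduced_step (last z p2) y ->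
    \sum_(h <- y :: p1) f h.1 + \sum_(h <- z :: p2) f h.1 = 0.
  move=> yp1 zp2 p1z p2y; rewrite -big_cat; apply: sum_cyclically_reduced.
  by rewrite /= rcons_path cat_path last_cat /= yp1 p1z zp2 p2y.
move=> xp p_x; have [opp_x|xN] := eqVneq (last x p) (opposite x); last first.
  apply: sum_cyclically_reduced; rewrite /= rcons_path xp /reduced_step p_x eqxx.
  rewrite -(inj_eq (inv_inj (@opposite_involutive E))) opposite_involutive.
  by rewrite eq_sym.
(* The walk leaves its base point by [x] and returns by its reverse; valency 3 leaves two further
   oriented edges [a] and [b] starting there. *)
have [a [b [xa xb ab]]] : exists a b, [/\ reduced_step (opposite x) a,
    reduced_step (opposite x) b & a != b].
  have /card_gt1P[a [b []]] := card_successors (opposite x).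
  by rewrite !inE => xa xb ab; exists a, b.
have loop_at h : exists2 q, path reduced_step h q & last h q = opposite h.
  by have /connectP[q hq ->] := connect_to_opposite h; exists q.
have [qa aq qaE] := loop_at a; have [qb bq qbE] := loop_at b.
have sym y z : reduced_step (opposite y) z -> reduced_step (opposite z) y.
  by rewrite reduced_step_opposite opposite_involutive.
have sxa := cat_sum _ _ _ _ xp aq.
have sxb := cat_sum _ _ _ _ xp bq.
have sab := cat_sum _ _ _ _ aq bq.
rewrite opp_x qaE in sxa; rewrite opp_x qbE in sxb; rewrite qaE qbE in sab.
have a'b : reduced_step (opposite a) b.
  move: xa xb => /andP[/eqP xa _] /andP[/eqP xb _].
  rewrite /reduced_step opposite_involutive [b == a]eq_sym ab andbT.
  by rewrite /target -/(source G a) -xa xb.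
(* Any two of the three sums add up to 0, so twice each of them is 0. *)
move: (sxa xa (sym _ _ xa)) (sxb xb (sym _ _ xb)) (sab a'b (sym _ _ a'b)).
move=> /eqP; rewrite addr_eq0 => /eqP -> /eqP; rewrite addrC subr_eq0 => /eqP ->.
by move/eqP; rewrite -mulr2n mulrn_eq0 /= => /eqP ->; rewrite oppr0.
Qed.

Lemma vanishes_on_half_edges h : f h.1 = 0.
Proof.
have /connectP[p] := connect_to_opposite h.
case/lastP: p => [_ /eqP|p z]; first by rewrite (negbTE (opposite_neq h)).
rewrite last_rcons => + zE; rewrite -{}zE => hp.
have := sum_closed_reduced hp.
rewrite last_rcons -cats1 big_cons big_cat big_seq1 /= => /(_ erefl).
(* An empty middle part would make [opposite h] directly follow [h]; otherwise it is a closed walk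
   based at the target of [h]. *)
move: hp; rewrite rcons_path; case: p => [|y p] /=.
  by rewrite /reduced_step eqxx andbF.
case/andP=> /andP[/andP[/eqP hy _] yp] /andP[/eqP ph _].
rewrite (sum_closed_reduced yp) ?add0r; last first.
  by rewrite ph -hy /source opposite_involutive.
by move/eqP; rewrite -mulr2n mulrn_eq0 /= => /eqP.
Qed.

End Walks.

Theorem propositionA1 (R : realType) (V E : finType) (G : graph V E)
    (hval : forall v : V, (3 <= valency G v)%N)
    (f : E -> R)
    (hf : forall (V1 E1 : Type) (G1 : graph V1 E1) (p : covering G1 G)
            (n : nat) (c : 'I_n -> E1 * bool),
          is_loop G1 c -> loop_sum (fun e1 : E1 => f (cov_edge p e1)) c = 0) :
  forall e : E, f e = 0.
Proof.
by move=> e; apply: (vanishes_on_half_edges hval hf (e, true)).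
Qed.
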